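(* For every $\times$-free ordered graph $(G,\le)$, $\mathrm{tw}(G)\le 15\,\mathrm{had}(G)-2$.
   Context: An ordered graph $(G,\le)$ is a graph with a total order $\le$ on its vertex set. Two edges $uv,xy$ with four distinct endpoints, $u<v$ and $x<y$, cross if $u<x<v<y$ or $x<u<y<v$. $(G,\le)$ is $\times$-free if for every pair of crossing edges $uv,xy$, at least one of $ux,uy,vx,vy$ is an edge of $G$. $\mathrm{tw}$ denotes treewidth and $\mathrm{had}(G)$ the largest $t$ with $K_t$ a minor of $G$. *)

(* Defs.v *)
From mathcomp Require Import all_boot all_order all_algebra.
From mathcomp Require Import boolp.

Set Implicit Arguments.
Unset Strict Implicit.
Unset Printing Implicit Defensive.

Import Order.TTheory.

(* A finite simple graph is a symmetric irreflexive relation on a finType; an *)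
(* ordered graph is such a relation on a finOrderType.                        *)

Section Connectivity.
Variables (V : finType) (e : rel V).

Definition induced (A : {set V}) : rel V :=
  [rel x y | [&& e x y, x \in A & y \in A]].

(* The empty set counts as connected. *)
Definition connected_set (A : {set V}) : bool :=
  [forall x in A, forall y in A, connect (induced A) x y].

(* [ucycle] also accepts [:: x; y] when x and y are adjacent, whence the      *)
(* bound 2.                                                                   *)
Definition is_tree : Prop :=
  [/\ symmetric e, irreflexive e, 0 < #|V|, connected_set [set: V]
    & forall c : seq V, ucycle e c -> size c <= 2].

End Connectivity.

Section TreeDecomposition.
Variables (V : finType) (e : rel V).

Definition is_tree_decomposition (T : finType) (eT : rel T) (B : T -> {set V})
    : Prop :=
  [/\ is_tree eT,
      forall v, exists t, v \in B t,
      forall u v, e u v -> exists t, (u \in B t) && (v \in B t)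
    & forall v, connected_set eT [set t | v \in B t]].

(* When V is nonempty some bag is nonempty, so the predecessor is exact.      *)
Definition width (T : finType) (B : T -> {set V}) : nat :=
  (\max_(t : T) #|B t|).-1.

Definition has_tree_decomposition (k : nat) : Prop :=
  exists (T : finType) (eT : rel T) (B : T -> {set V}),
    is_tree_decomposition eT B /\ width B = k.

Lemma ex_tree_decomposition : exists k, `[< has_tree_decomposition k >].
Proof.
pose B (_ : unit) := [set: V].
exists (width B); apply/asboolP; exists unit, (fun _ _ => false), B.
split=> //; split.
- split=> //; first by rewrite card_unit.
    by apply/forall_inP => -[] _; apply/forall_inP => -[] _.
  by move=> [|x [|y c]].
- by move=> v; exists tt; rewrite inE.
- by move=> u v _; exists tt; rewrite !inE.
- by move=> v; apply/forall_inP => -[] _; apply/forall_inP => -[] _.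
Qed.

Definition treewidth : nat := ex_minn ex_tree_decomposition.

End TreeDecomposition.

Definition is_minor_model (W V : finType) (h : rel W) (e : rel V)
    (B : {ffun W -> {set V}}) : bool :=
  [&& [forall w, (B w != set0) && connected_set e (B w)],
      [forall w, forall w', (w != w') ==> [disjoint B w & B w']]
    & [forall w, forall w', h w w' ==>
        [exists x in B w, exists y in B w', e x y]]].

Definition is_minor (W V : finType) (h : rel W) (e : rel V) : bool :=
  [exists B : {ffun W -> {set V}}, is_minor_model h e B].

Definition complete_graph (t : nat) : rel 'I_t := [rel i j | i != j].

Section Hadwiger.
Variables (V : finType) (e : rel V).

Lemma ex_complete_minor : exists t, is_minor (@complete_graph t) e.
Proof.
exists 0; apply/existsP; exists [ffun=> set0].
by apply/and3P; split; apply/forallP => -[].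
Qed.

Lemma complete_minor_bound t : is_minor (@complete_graph t) e -> t <= #|V|.
Proof.
case/existsP => B /and3P[/forallP B_ne /forallP B_dis _].
have B_ex i : exists x, x \in B i by apply/set0Pn; case/andP: (B_ne i).
have B_in i : xchoose (B_ex i) \in B i by exact: xchooseP (B_ex i).
rewrite -[t in t <= _]card_ord.
apply: (@leq_card _ _ (fun i => xchoose (B_ex i))) => i j eq_ij.
apply/eqP; apply: contraT => ne_ij.
have /forallP/(_ j)/implyP/(_ ne_ij) dis := B_dis i.
by have := disjointFr dis (B_in i); rewrite eq_ij B_in.
Qed.

Definition hadwiger : nat := ex_maxn ex_complete_minor complete_minor_bound.

End Hadwiger.

Section Ordered.
Variables (d : Order.disp_t) (V : finOrderType d).

(* The strict inequalities force u < v, x < y and four distinct endpoints.    *)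
Definition crossing (u v x y : V) : bool :=
  ((u < x)%O && (x < v)%O && (v < y)%O) ||
  ((x < u)%O && (u < y)%O && (y < v)%O).

Definition times_free (e : rel V) : Prop :=
  forall u v x y, e u v -> e x y -> crossing u v x y ->
    [|| e u x, e u y, e v x | e v y].

End Ordered.

(* Main.v *)
Require Import Defs.
From mathcomp Require Import all_boot all_order all_algebra zify.

Set Implicit Arguments.
Unset Strict Implicit.
Unset Printing Implicit Defensive.

(* Read the order as a cyclic order. Two disjoint connected sets that do not  *)
(* touch cannot interleave, so two disjoint connected sets meeting the same   *)
(* three intervals always touch. Put h = had(G), cut V into four consecutive  *)
(* intervals 0, 1, 2, 3, and suppose there were 3h disjoint connected sets    *)
(* joining 0 to 2 and 3h joining 1 to 3. Among the former at most h meet      *)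
(* interval 1 and at most h meet interval 3, as those would be pairwise       *)
(* touching; so h of them lie inside 0 and 2, and likewise h of the latter    *)
(* lie inside 1 and 3. These touch in a K_{h,h} pattern, which contains a     *)
(* K_{h+1} minor. By Menger's theorem fewer than 3h vertices separate 0 from  *)
(* 2 or 1 from 3. Hence every W with 12h vertices has a separator of size     *)
(* less than 3h all of whose components contain at most 9h vertices of W, and *)
(* the usual recursion gives bags of size at most 15h - 1.                    *)

(** * Connected sets *)

(** Interleaving is measured by parities. For two edges with distinct, pairwise non-adjacent ends,
    the absence of crossings says that [u] and [v] lie on the same arc of the circle cut at [x] and
    [y] ([crossing_free_parity]). Moving along edges spreads this over two connected sets that do
    not touch ([untouched_parity]), and both touching criteria follow: [three_intervals_touch] and
    [crossing_touch]. [not_both_linked] derives the contradiction with the Hadwiger number, [menger]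
    turns it into a small separator, and [balanced_separator] places the cuts so that each interval
    holds a quarter of [W]. [separator_decomposition] is the recursion: with q = 3h, a bag has at
    most 4q vertices plus a separator of fewer than q, hence at most 5q - 1 = 15h - 1, and the width
    is one less. *)

Section Connected.
Variable V : finType.
Implicit Types (e r : rel V) (A B K X : {set V}).

Lemma connect_stable r (P : pred V) x y :
  (forall u v, r u v -> P u -> P v) -> connect r x y -> P x -> P y.
Proof.
move=> Pr /connectP[p]; elim: p x => [x _ -> //|z p IHp x /= /andP[rxz pz] yE Px].
exact: IHp pz yE (Pr _ _ rxz Px).
Qed.

Lemma induced_sym e A : symmetric e -> symmetric (induced e A).
Proof. by move=> e_sym x y; rewrite /induced /= e_sym [(_ \in _) && _]andbC. Qed.

Lemma induced_connect_sym e A : symmetric e -> connect_sym (induced e A).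
Proof. by move=> e_sym; apply: sym_connect_sym; apply: induced_sym. Qed.

Lemma connect_induced_mono e e' A A' : subrel e e' -> A \subset A' ->
  subrel (connect (induced e A)) (connect (induced e' A')).
Proof.
move=> ee' /subsetP AA'; apply: connect_sub => x y /and3P[/ee' exy xA yA].
by apply: connect1; rewrite /induced /= exy !AA'.
Qed.

Lemma connected_setP e A :
  reflect {in A &, forall x y, connect (induced e A) x y} (connected_set e A).
Proof.
apply: (iffP forall_inP) => [H x y xA|H x xA]; first exact: (forall_inP (H x xA)).
by apply/forall_inP => y; apply: H.
Qed.

Lemma connected_set_mono e e' A : subrel e e' -> connected_set e A -> connected_set e' A.
Proof.
move=> ee' /connected_setP cA; apply/connected_setP => x y xA yA.
exact: connect_induced_mono ee' (subxx A) _ _ (cA x y xA yA).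
Qed.

Lemma connected_set1 e x : connected_set e [set x].
Proof. by apply/connected_setP => u v /set1P-> /set1P->; apply: connect0. Qed.

Lemma connected_set_from e A z : symmetric e ->
  (forall x, x \in A -> connect (induced e A) z x) -> connected_set e A.
Proof.
move=> e_sym zA; apply/connected_setP => x y xA yA.
by apply: connect_trans (zA y yA); rewrite induced_connect_sym // zA.
Qed.

(** The disjunction covers the two ways of gluing in Menger's theorem: at a common vertex of the
    separator, or across the deleted edge. *)
Lemma connected_setU e A B x y : symmetric e -> connected_set e A ->
    connected_set e B -> x \in A -> y \in B -> (x == y) || e x y ->
  connected_set e (A :|: B).
Proof.
move=> e_sym /connected_setP cA /connected_setP cB xA yB exy.
apply: (connected_set_from (z := x)) => // z.
rewrite inE => /orP[zA|zB].
  exact: connect_induced_mono (fun _ _ h => h) (subsetUl A B) _ _ (cA _ _ xA zA).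
apply: connect_trans (connect_induced_mono (fun _ _ h => h) (subsetUr A B) (cB _ _ yB zB)).
case/orP: exy => [/eqP->|exy]; first exact: connect0.
by apply: connect1; rewrite /induced /= exy !inE xA yB orbT.
Qed.

Lemma connected_set_const (T : eqType) (f : V -> T) e K :
    {in K &, forall u v, e u v -> f u = f v} -> connected_set e K ->
  {in K &, forall x y, f x = f y}.
Proof.
move=> fK /connected_setP cK x y xK yK.
apply/eqP; apply: (connect_stable (P := fun z => f x == f z)) (cK x y xK yK) _ => //.
by move=> u v /and3P[euv uK vK] /eqP->; rewrite (fK u v).
Qed.

Definition touch e A B := [exists x in A, exists y in B, e x y].

Lemma touchP e A B :
  reflect (exists x y, [/\ x \in A, y \in B & e x y]) (touch e A B).
Proof.
apply: (iffP exists_inP) => [[x xA /exists_inP[y yB exy]]|[x [y [xA yB exy]]]].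
  by exists x, y.
by exists x => //; apply/exists_inP; exists y.
Qed.

Lemma touch_sym e A B : symmetric e -> touch e A B = touch e B A.
Proof.
move=> e_sym; apply/touchP/touchP => -[x [y [? ? exy]]]; exists y, x; split=> //;
by rewrite e_sym.
Qed.

Lemma touchS e A A' B B' :
  A \subset A' -> B \subset B' -> touch e A B -> touch e A' B'.
Proof.
move=> /subsetP AA' /subsetP BB' /touchP[x [y [/AA' ? /BB' ? ?]]].
by apply/touchP; exists x, y.
Qed.

End Connected.

(** * Menger's theorem *)

Section Menger.
Variable V : finType.
Implicit Types (e : rel V) (A B X : {set V}).

Definition separates e A B X :=
  [forall a in A :\: X, forall b in B :\: X, ~~ connect (induced e (~: X)) a b].

(** Disjoint connected sets replace the usual disjoint paths: they serve directly as branch sets of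
    a minor, and gluing two of them needs no care about the shape of the result. *)
Definition linked e A B k := exists F : 'I_k -> {set V},
  [/\ forall i, connected_set e (F i),
      forall i, exists2 a, a \in F i & a \in A,
      forall i, exists2 b, b \in F i & b \in B
    & forall i j, i != j -> [disjoint F i & F j]].

Lemma separatesP e A B X :
  reflect (forall a b, a \in A :\: X -> b \in B :\: X ->
             ~~ connect (induced e (~: X)) a b)
          (separates e A B X).
Proof.
apply: (iffP forall_inP) => [H a b aA|H a aA]; first exact: (forall_inP (H a aA)).
by apply/forall_inP => b; apply: H.
Qed.

Lemma separates_closed e A B X (Z : {set V}) :
    A :\: X \subset Z -> [disjoint Z & B :\: X] ->
    (forall u v, u \in Z -> v \notin X -> e u v -> v \in Z) ->
  separates e A B X.
Proof.
move=> /subsetP AZ ZB Zcl; apply/separatesP => a b aA bB; apply/negP => cab.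
have bZ : b \in Z.
  apply: (connect_stable (P := mem Z)) cab (AZ _ aA) => u v /and3P[euv _].
  by rewrite inE => vX uZ; apply: Zcl uZ vX euv.
by move: (disjointFr ZB bZ); rewrite bB.
Qed.

Lemma separates_sym e A B X : symmetric e -> separates e A B X = separates e B A X.
Proof.
move=> e_sym.
by apply/separatesP/separatesP => H a b aA bB; rewrite induced_connect_sym // H.
Qed.

(** The side of [A] after deleting [X]; it contains no vertex of [X]. *)
Definition reach e A X := [set v | [exists a in A :\: X, connect (induced e (~: X)) a v]].

Lemma reach_sub e A X : A :\: X \subset reach e A X.
Proof.
by apply/subsetP => a aA; rewrite inE; apply/exists_inP; exists a => //; apply: connect0.
Qed.

Lemma reach_disjoint e A X : [disjoint reach e A X & X].
Proof.
apply/pred0P => v /=; rewrite inE; apply/negbTE/negP => /andP[/exists_inP[a aA cav] vX].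
have: v \in ~: X; last by rewrite inE vX.
apply: (connect_stable (P := mem (~: X))) cav _ => [u w /and3P[]//|].
by move: aA; rewrite !inE => /andP[].
Qed.

Lemma reach_closed e A X u v :
  u \in reach e A X -> v \notin X -> e u v -> v \in reach e A X.
Proof.
move=> uR vX euv; have uX := disjointFr (reach_disjoint e A X) uR.
move: uR; rewrite !inE => /exists_inP[a aA cau]; apply/exists_inP; exists a => //.
by apply: connect_trans cau (connect1 _); rewrite /induced /= euv !inE uX.
Qed.

Lemma separates_reach e A B X : separates e A B X -> [disjoint reach e A X & B].
Proof.
move=> /separatesP sX; apply/pred0P => v /=; apply/negbTE/negP => /andP[vR vB].
have vX := disjointFr (reach_disjoint e A X) vR.
move: vR; rewrite inE => /exists_inP[a aA]; apply/negP; apply: sX => //.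
by rewrite inE vX.
Qed.

Definition del_edge e x y : rel V :=
  [rel u v | e u v && ~~ ((u == x) && (v == y) || (u == y) && (v == x))].

Lemma del_edge_sym e x y : symmetric e -> symmetric (del_edge e x y).
Proof.
by move=> e_sym u v; rewrite /del_edge /= e_sym; congr (_ && ~~ _);
  rewrite orbC ![(v == _) && _]andbC.
Qed.

Definition edges e := [set p : V * V | e p.1 p.2].

Lemma linked_mono e e' A B k : subrel e e' -> linked e A B k -> linked e' A B k.
Proof.
move=> ee' [F [cF FA FB Fd]]; exists F; split=> // i.
exact: connected_set_mono ee' (cF i).
Qed.

Lemma linked_leq e A B k k' : k' <= k -> linked e A B k -> linked e A B k'.
Proof.
move=> le_k [F [cF FA FB Fd]]; exists (F \o widen_ord le_k); split=> //= i j ij.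
by apply: Fd; apply: contraNneq ij => /(congr1 val) /= /val_inj->.
Qed.

(** A set [T] that cuts [A] from [x |: S] inside the [A]-side of [S] already cuts [A] from [B] in
    [e]. Indeed the part [Z] reached from [A] avoids [x] and [S], so it stays in the [A]-side, which
    misses [y] and [B]; no edge leaving a vertex of [Z] is then the deleted one. *)
Lemma menger_side e e' A B S x y k :
    (forall X, separates e A B X -> k <= #|X|) ->
    (forall u v, e u v -> u != x -> u != y -> e' u v) ->
    separates e' A B S -> y \notin reach e' A S ->
  forall T, separates (induced e' (reach e' A S :|: S)) A (x |: S) T -> k <= #|T|.
Proof.
set R := reach e' A S => k_min ee' sS yR T sT; apply: k_min.
set e1 := induced e' (R :|: S) in sT *; set Z := reach e1 A T.
have ZS : [disjoint Z & x |: S] := separates_reach sT.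
have ZR : Z \subset R.
  apply/subsetP => v vZ.
  have: v \in R :|: S.
    move: (vZ); rewrite inE => /exists_inP[a aA cav].
    apply: (connect_stable (P := mem (R :|: S))) cav _.
      by move=> u w /and3P[/and3P[]].
    have [aS|aS] := boolP (a \in S); first by rewrite /= inE aS orbT.
    rewrite /= inE (subsetP (reach_sub _ _ _)) // inE aS.
    by case/setDP: aA.
  rewrite inE => /orP[//|vS].
  by move: (disjointFr ZS vZ); rewrite !inE vS orbT.
apply: (separates_closed (Z := Z)).
- exact: reach_sub.
- apply/pred0P => v /=; apply/negbTE/negP => /andP[/(subsetP ZR) vR].
  by rewrite !inE => /andP[_ vB]; move: (disjointFr (separates_reach sS) vR); rewrite vB.
- move=> u v uZ vT euv; have uR := subsetP ZR _ uZ.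
  have ux : u != x by apply: contraFneq (disjointFr ZS uZ) => ->; rewrite !inE eqxx.
  have uy : u != y by apply: contraNneq yR => <-.
  have e'uv : e' u v by apply: ee'.
  apply: reach_closed uZ vT _; rewrite /e1 /induced /= e'uv !in_setU uR /=.
   by have [_|vS] := boolP (v \in S); rewrite ?orbT // (reach_closed uR vS e'uv).
Qed.

Lemma connected_induced_sub e A F :
  connected_set (induced e A) F -> (exists2 a, a \in F & a \in A) -> F \subset A.
Proof.
move=> /connected_setP cF [a aF aA]; apply/subsetP => v vF.
apply: (connect_stable (P := mem A)) (cF a v aF vF) aA.
by move=> u w /and3P[/and3P[]].
Qed.

(** Disjointness makes [f] injective, and counting makes it a bijection onto [S]; each [F i]
    therefore meets [S] in [f i] only. *)
Lemma linked_transversal (k : nat) (F : 'I_k -> {set V}) (S : {set V}) (f : 'I_k -> V) :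
    (forall i j, i != j -> [disjoint F i & F j]) -> #|S| = k ->
    (forall i, f i \in F i) -> (forall i, f i \in S) ->
  (forall s, s \in S -> exists i, f i = s) /\
  (forall i s, s \in S -> s \in F i -> s = f i).
Proof.
move=> Fd cS fF fS.
have uniqF i j s : s \in F i -> s \in F j -> i = j.
  move=> si sj; apply/eqP; apply: contraT => ij.
  by move: (disjointFr (Fd _ _ ij) si); rewrite sj.
have f_inj : injective f.
  by move=> i j fij; apply: (uniqF i j (f i)) => //; rewrite fij.
have fim : f @: [set: 'I_k] = S.
  apply/eqP; rewrite eqEcard card_imset // cardsT card_ord cS leqnn andbT.
  by apply/subsetP => _ /imsetP[i _ ->].
have fS' s : s \in S -> exists i, f i = s.
  by rewrite -fim => /imsetP[i _ ->]; exists i.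
split=> // i s /fS'[j <-] fj.
by rewrite (uniqF i j (f j)).
Qed.

(* Goring's proof: delete an edge [x y]. If some [S] with fewer than k        *)
(* vertices now separates A from B, apply induction on the A-side of [S] with *)
(* target [x |: S] and on the B-side with target [y |: S], then join the two  *)
(* families along [S] and through [x y].                                      *)
Theorem menger e A B k : symmetric e ->
  (forall X, separates e A B X -> k <= #|X|) -> linked e A B k.
Proof.
have [n] := ubnP #|edges e|; elim: n e A B => // n IHn e A B; rewrite ltnS => en e_sym k_min.
(* Without edges [A :&: B] separates, so it has at least k vertices, and these are the required sets
   as singletons. *)
have [E0|] := set_0Vmem (edges e).
  have le_k : k <= #|A :&: B|.
    apply: k_min; apply: (separates_closed (Z := A :\: B)).
    - by apply/subsetP => v; rewrite !inE; case: (v \in A); case: (v \in B).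
    - by apply/pred0P => v /=; rewrite !inE; case: (v \in A); case: (v \in B).
    - by move=> u v _ _ euv; move/setP/(_ (u, v)): E0; rewrite !inE /= euv.
  apply: (linked_leq le_k); exists (fun i => [set enum_val i]).
  have ABP (i : 'I_#|A :&: B|) := enum_valP i.
  split=> [i|i|i|i j ij]; first exact: connected_set1.
  - by exists (enum_val i); [rewrite inE | case/setIP: (ABP i)].
  - by exists (enum_val i); [rewrite inE | case/setIP: (ABP i)].
  - by rewrite disjoints1 inE (inj_eq enum_val_inj).
case=> -[x0 y0]; rewrite inE /= => exy0.
have del_lt (r : rel V) x y : e x y -> subrel r (del_edge e x y) -> #|edges r| < n.
  move=> exy re; apply: leq_trans en; apply: proper_card; apply/properP; split.
    by apply/subsetP => -[u v]; rewrite !inE => /re/andP[].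
  exists (x, y); rewrite inE //=; apply: contraTN isT => /re.
  by rewrite /del_edge /= !eqxx andbF.
have [noS|] := boolP [forall X, separates (del_edge e x0 y0) A B X ==> (k <= #|X|)].
  apply: linked_mono (IHn (del_edge e x0 y0) A B _ _ _) => [u v /andP[]//|||X].
  - exact: del_lt exy0 _.
  - exact: del_edge_sym.
  - by move/implyP: (forallP noS X).
rewrite negb_forall => /existsP[S]; rewrite negb_imply -ltnNge => /andP[sS0 Sk].
have nsS : ~~ separates e A B S by apply: contraTN Sk => /k_min; rewrite leqNgt.
have e'_sym0 := del_edge_sym x0 y0 e_sym.
have nsS' : ~~ separates e B A S by rewrite separates_sym.
have sS0' : separates (del_edge e x0 y0) B A S by rewrite separates_sym.
(* Only the deleted edge can leave the [A']-side of [S] without entering [S]; as [S] fails to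
   separate in [e], exactly one end of that edge lies on this side. *)
have leave A' B' : separates (del_edge e x0 y0) A' B' S -> ~~ separates e A' B' S ->
    ((x0 \in reach (del_edge e x0 y0) A' S) && (y0 \notin reach (del_edge e x0 y0) A' S)) ||
    ((y0 \in reach (del_edge e x0 y0) A' S) && (x0 \notin reach (del_edge e x0 y0) A' S)).
  move=> sS' ns; set R := reach _ _ _; apply: contraR ns.
  rewrite negb_or !negb_and !negbK => /andP[xR yR].
  apply: (separates_closed (Z := R)).
  - exact: reach_sub.
  - by apply: disjointWr (separates_reach sS'); apply: subsetDl.
  - move=> u v uR vS euv; have [e'uv|] := boolP (del_edge e x0 y0 u v).
      exact: reach_closed uR vS e'uv.
    rewrite /del_edge /= euv /= negbK => /orP[]/andP[/eqP uE /eqP vE]; subst u v.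
      by move: xR; rewrite uR.
    by move: yR; rewrite uR.
have RAB : [disjoint reach (del_edge e x0 y0) A S & reach (del_edge e x0 y0) B S].
  apply/pred0P => v /=; apply/negbTE/negP => /andP[].
  rewrite !inE => /exists_inP[a aA cav] /exists_inP[b bB].
  rewrite induced_connect_sym // => cvb.
  by move/separatesP: sS0 => /(_ a b aA bB); rewrite (connect_trans cav cvb).
set e' := del_edge e x0 y0 in sS0 e'_sym0 sS0' leave RAB.
set RA := reach e' A S in RAB; set RB := reach e' B S in RAB.
(* The two sides are disjoint, so the edge can be named with [x] on the side of [A] and [y] on the
   side of [B]. *)
have [x [y [exy xR yR ee']]] : exists x y, [/\ e x y, x \in RA, y \in RB &
    forall u v, e u v -> u != x -> u != y -> e' u v].
  have := leave B A sS0' nsS'; have := leave A B sS0 nsS.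
  case/orP=> /andP[zA zA'] /orP[]/andP[zB zB'].
  - by move: (disjointFr RAB zA); rewrite zB.
  - by exists x0, y0; split=> // u v euv ux uy; rewrite /e' /del_edge /= euv (negPf ux) (negPf uy).
  - exists y0, x0; rewrite e_sym; split=> // u v euv ux uy.
    by rewrite /e' /del_edge /= euv (negPf ux) (negPf uy).
  - by move: (disjointFr RAB zA); rewrite zB.
have yRA : y \notin RA by rewrite (disjointFl RAB yR).
have xRB : x \notin RB by rewrite (disjointFr RAB xR).
have k_min' X : separates e B A X -> k <= #|X| by rewrite separates_sym //; apply: k_min.
have kA := menger_side k_min ee' sS0 yRA.
have kB : forall T, separates (induced e' (RB :|: S)) B (y |: S) T -> k <= #|T|.
  by apply: (menger_side (x := y) (y := x) k_min') => // u v euv uy ux; apply: ee'.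
have xS : x \notin S by rewrite (disjointFr (reach_disjoint _ _ _) xR).
have yS : y \notin S by rewrite (disjointFr (reach_disjoint _ _ _) yR).
(* [x |: S] trivially separates [A] from itself, so [kA] bounds its size below; equality is what
   lets both families hit their targets bijectively. *)
have Sk1 : k = #|S|.+1.
  apply/eqP; rewrite eqn_leq Sk andbT.
  have -> : #|S|.+1 = #|x |: S| by rewrite cardsU1 xS.
  apply: kA; apply/separatesP => a b _.
  by rewrite setDv inE.
have e'e : subrel e' e by move=> u v /andP[].
have del_ind Z : #|edges (induced e' Z)| < n.
  by apply: del_lt exy0 _ => u v /andP[].
have [F [cF FA FS Fd]] := IHn _ _ _ (del_ind _) (induced_sym _ e'_sym0) kA.
have [G [cG GB GS Gd]] := IHn _ _ _ (del_ind _) (induced_sym _ e'_sym0) kB.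
have inF i : exists v, (v \in F i) && (v \in x |: S).
  by have [v ? ?] := FS i; exists v; apply/andP.
have inG i : exists v, (v \in G i) && (v \in y |: S).
  by have [v ? ?] := GS i; exists v; apply/andP.
pose f i := xchoose (inF i); pose g i := xchoose (inG i).
have fF i : f i \in F i by case/andP: (xchooseP (inF i)).
have fS i : f i \in x |: S by case/andP: (xchooseP (inF i)).
have gG i : g i \in G i by case/andP: (xchooseP (inG i)).
have gS i : g i \in y |: S by case/andP: (xchooseP (inG i)).
have cx : #|x |: S| = k by rewrite cardsU1 xS Sk1.
have cy : #|y |: S| = k by rewrite cardsU1 yS Sk1.
have [_ f_uniq] := linked_transversal Fd cx fF fS.
have [g_onto g_uniq] := linked_transversal Gd cy gG gS.
(* The set of [F] ending at [x] is matched with the set of [G] ending at [y]; all others are matched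
   through their common vertex of [S]. *)
have sigP i : exists j, g j == (if f i == x then y else f i).
  have [j gj] : exists j, g j = (if f i == x then y else f i); last by exists j; apply/eqP.
  apply: g_onto; case: eqP => [_|/eqP fx]; first exact: setU11.
  by move: (fS i); rewrite !inE (negPf fx) => /= ->; rewrite orbT.
pose sig i := xchoose (sigP i).
have gsig i : g (sig i) = (if f i == x then y else f i) by apply/eqP/(xchooseP (sigP i)).
have FRA i : F i \subset RA :|: S.
  apply: connected_induced_sub (cF i) _; exists (f i); rewrite // in_setU.
  by move: (fS i); rewrite in_setU1 => /orP[/eqP->|->]; rewrite ?xR ?orbT.
have GRB i : G i \subset RB :|: S.
  apply: connected_induced_sub (cG i) _; exists (g i); rewrite // in_setU.
  by move: (gS i); rewrite in_setU1 => /orP[/eqP->|->]; rewrite ?yR ?orbT.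
(* The two sides share no vertex, so a common point lies in [S], where it is the endpoint of both
   sets; only matched sets can meet. *)
have FG i j z : z \in F i -> z \in G j -> j = sig i.
  move=> zF zG.
  have zS : z \in S.
    move: (subsetP (FRA i) _ zF) (subsetP (GRB j) _ zG); rewrite !in_setU.
    by case/orP => [zA|//] /orP[zB|//]; rewrite (disjointFr RAB zA) in zB.
  have zf : z = f i by apply: f_uniq zF; rewrite inE zS orbT.
  have zg : z = g j by apply: g_uniq zG; rewrite inE zS orbT.
  have zx : z != x by apply: contraNneq xS => <-.
  apply/eqP; apply: contraT => ij.
  move: (disjointFr (Gd _ _ ij) zG); suff -> : z \in G (sig i) by [].
  by rewrite zf in zx *; rewrite -[f i](_ : g (sig i) = _) ?gG // gsig (negPf zx).
have sig_inj : injective sig.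
  move=> i j sij; have := gsig i; rewrite sij gsig.
  have fy l : f l != y.
    apply/eqP => fly; move: (fS l); rewrite fly !inE (negPf yS) orbF => /eqP yx.
    by rewrite -yx yR in xRB.
  have ff l m : f l = f m -> l = m.
    move=> flm; apply/eqP; apply: contraT => lm.
    by move: (disjointFr (Fd _ _ lm) (fF l)); rewrite flm fF.
  case: eqP => [fj|_]; case: eqP => [fi|_] E; first by apply: ff; rewrite fi fj.
  - by move: (fy i); rewrite -E eqxx.
  - by move: (fy j); rewrite E eqxx.
  - by apply: ff.
exists (fun i => F i :|: G (sig i)); split=> [i|i|i|i j ij].
- apply: (connected_setU (x := f i) (y := g (sig i))) => //.
  + by apply: connected_set_mono (cF i) => u v /and3P[/e'e].
  + by apply: connected_set_mono (cG (sig i)) => u v /and3P[/e'e].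
  + by rewrite gsig; case: (f i =P x) => [->|_]; rewrite ?exy ?eqxx ?orbT.
- by have [a aF aA] := FA i; exists a; rewrite // inE aF.
- by have [b bG bB] := GB (sig i); exists b; rewrite // inE bG orbT.
- apply/pred0P => z /=; apply/negbTE/negP; rewrite !inE => /andP[/orP[zi|zi] /orP[zj|zj]].
  + by move: (disjointFr (Fd _ _ ij) zi); rewrite zj.
  + by move: (FG _ _ _ zi zj) => /sig_inj ji; rewrite ji eqxx in ij.
  + by move: (FG _ _ _ zj zi) => /sig_inj ji; rewrite ji eqxx in ij.
  + have sij : sig i != sig j by rewrite (inj_eq sig_inj).
    by move: (disjointFr (Gd _ _ sij) zi); rewrite zj.
Qed.

End Menger.

(** * Complete minors *)

Section HadwigerBound.
Variables (V : finType) (e : rel V).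
Hypothesis e_sym : symmetric e.

Lemma hadwiger_ge (I : finType) (J : {set I}) (S : I -> {set V}) :
    {in J, forall i, (S i != set0) && connected_set e (S i)} ->
    {in J &, forall i j, i != j -> [disjoint S i & S j] && touch e (S i) (S j)} ->
  #|J| <= hadwiger e.
Proof.
move=> SJ SJ2; rewrite /hadwiger; case: ex_maxnP => m _; apply.
apply/existsP; exists [ffun i : 'I_#|J| => S (enum_val i)].
have vJ (i : 'I_#|J|) := enum_valP i.
have vN (i j : 'I_#|J|) : i != j -> enum_val i != enum_val j by rewrite (inj_eq enum_val_inj).
apply/and3P; split; apply/forallP => i.
- by rewrite ffunE SJ.
- apply/forallP => j; apply/implyP => ij; rewrite !ffunE.
  by have /andP[] := SJ2 _ _ (vJ i) (vJ j) (vN i j ij).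
- apply/forallP => j; apply/implyP => ij; rewrite !ffunE.
  by have /andP[] := SJ2 _ _ (vJ i) (vJ j) (vN i j ij).
Qed.

Lemma hadwiger_gt0 : 0 < #|V| -> 0 < hadwiger e.
Proof.
case/card_gt0P => v _.
rewrite -(cards1 tt); apply: (hadwiger_ge (S := fun=> [set v])).
  by move=> i _; rewrite connected_set1 andbT; apply/set0Pn; exists v; rewrite inE.
by move=> [] [].
Qed.

(* [K_{n,n}] contains [K_{n+1}] as a minor: contract a matching of size n-1. *)
Lemma hadwiger_bipartite n (P Q : 'I_n.+1 -> {set V}) :
    (forall i, (P i != set0) && connected_set e (P i)) ->
    (forall i, (Q i != set0) && connected_set e (Q i)) ->
    (forall i j, i != j -> [disjoint P i & P j]) ->
    (forall i j, i != j -> [disjoint Q i & Q j]) ->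
    (forall i j, [disjoint P i & Q j] && touch e (P i) (Q j)) ->
  n.+2 <= hadwiger e.
Proof.
move=> cP cQ Pd Qd PQ.
have PQd i j : [disjoint P i & Q j] by case/andP: (PQ i j).
have QPd i j : [disjoint Q i & P j] by rewrite disjoint_sym.
have PQt i j : touch e (P i) (Q j) by case/andP: (PQ i j).
pose w := widen_ord (leqnSn n).
have w_inj : injective w by move=> i j /(congr1 val) /= /val_inj.
have wm i : w i != ord_max by rewrite -val_eqE /= neq_ltn ltn_ord.
(* Branch sets: n matched pairs, plus the last [P] and the last [Q] left unmatched, n + 2 in all. *)
pose S (o : option (option 'I_n)) := match o with
  | None => P ord_max | Some None => Q ord_max | Some (Some i) => P (w i) :|: Q (w i) end.
have -> : n.+2 = #|[set: option (option 'I_n)]| by rewrite cardsT !card_option card_ord.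
apply: (hadwiger_ge (S := S)).
  case=> [[i|]|] _ /=; rewrite ?cP ?cQ //.
  have [/andP[/set0Pn[x xP] cPi] /andP[_ cQi]] := (cP (w i), cQ (w i)).
  apply/andP; split; first by apply/set0Pn; exists x; rewrite inE xP.
  have /touchP[a [b [aP bQ eab]]] := PQt (w i) (w i).
  by apply: connected_setU aP bQ _ => //; rewrite eab orbT.
have dtC (A B : {set V}) : [disjoint A & B] && touch e A B = [disjoint B & A] && touch e B A.
  by rewrite disjoint_sym touch_sym.
have W i : [disjoint P (w i) :|: Q (w i) & P ord_max] &&
           touch e (P (w i) :|: Q (w i)) (P ord_max).
  rewrite -setI_eq0 setIUl setU_eq0 !setI_eq0 Pd ?wm // QPd /=.
  by apply: touchS (subsetUr _ _) (subxx _) _; rewrite touch_sym.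
have W' i : [disjoint P (w i) :|: Q (w i) & Q ord_max] &&
           touch e (P (w i) :|: Q (w i)) (Q ord_max).
  rewrite -setI_eq0 setIUl setU_eq0 !setI_eq0 Qd ?wm // PQd /=.
  exact: touchS (subsetUl _ _) (subxx _) _.
case=> [[i|]|] [[j|]|] _ _ //= ij; rewrite ?W ?W' // ?PQ // 1?dtC ?W ?W' ?PQ //.
have wij : w j != w i by apply: contraNneq ij => /w_inj->.
rewrite -setI_eq0 setIUl !setIUr !setU_eq0 !setI_eq0 Pd // Qd // PQd QPd /=.
apply: touchS (subsetUl _ _) (subsetUr _ _) _; exact: PQt.
Qed.

End HadwigerBound.

(** * Separators of ordered graphs *)

Import Order.TTheory.

Section TimesFree.
Variables (d : Order.disp_t) (V : finOrderType d) (e : rel V).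
Hypotheses (e_sym : symmetric e) (e_free : times_free e).
Implicit Types (P Q : {set V}).

(** For [u] distinct from [x] and [y], the sum of the two comparisons is true exactly when [u] lies
    between them, so equality says that [x] and [y] do not separate [u] from [v]. Otherwise the
    edges would cross, and ×-freeness would give an adjacency. *)
Lemma crossing_free_parity u v x y : e u v -> e x y ->
    [&& u != x, u != y, v != x & v != y] -> ~~ [|| e u x, e u y, e v x | e v y] ->
  (u < x)%O (+) (u < y)%O = (v < x)%O (+) (v < y)%O.
Proof.
wlog uv : u v / (u < v)%O.
  move=> H euv exy /and4P[ux uy vx vy] ne.
  have [uv|vu|->//] := ltgtP u v; first by apply: H; rewrite // ux uy vx.
  apply/esym/H; rewrite ?ux ?uy ?vx ?vy //; first by rewrite e_sym.
  by apply: contra ne => /or4P[]->; rewrite ?orbT.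
wlog xy : x y / (x < y)%O.
  move=> H euv exy /and4P[ux uy vx vy] ne.
  have [xy|yx|->] := ltgtP x y; last by rewrite !addbb.
    by apply: H; rewrite // ux uy vx.
  rewrite addbC [RHS]addbC; apply: H; rewrite ?ux ?uy ?vx ?vy //; first by rewrite e_sym.
  by apply: contra ne => /or4P[]->; rewrite ?orbT.
move=> euv exy /and4P[ux uy vx vy]; apply: contraNeq => neq.
apply: (e_free euv exy); apply: contraNT neq; rewrite /crossing.
case: (ltgtP u x) ux => // [ltux|ltxu] _; case: (ltgtP v x) vx => // [ltvx|ltxv] _.
- by rewrite (lt_trans ltux xy) (lt_trans ltvx xy).
- by rewrite (lt_trans ltux xy); case: (ltgtP v y) vy.
- by have := lt_trans ltvx (lt_trans ltxu uv); rewrite ltxx.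
- case: (ltgtP u y) uy => // [ltuy|ltyu] _; case: (ltgtP v y) vy => //= ltvy _.
  by have := lt_trans ltvy (lt_trans ltyu uv); rewrite ltxx.
Qed.

(* If disjoint connected sets [P], [Q] do not touch, then no two vertices of *)
(* [P] are separated on the circle by two vertices of [Q].                   *)
Lemma untouched_parity P Q p1 p2 q1 q2 :
    connected_set e P -> connected_set e Q -> [disjoint P & Q] -> ~~ touch e P Q ->
    p1 \in P -> p2 \in P -> q1 \in Q -> q2 \in Q ->
  (p1 < q1)%O (+) (p1 < q2)%O = (p2 < q1)%O (+) (p2 < q2)%O.
Proof.
move=> cP cQ PQ nt p1P p2P q1Q q2Q.
have neqPQ p q : p \in P -> q \in Q -> p != q.
  by move=> pP qQ; apply: contraTneq qQ => <-; rewrite (disjointFr PQ pP).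
have nadj p q : p \in P -> q \in Q -> e p q = false.
  by move=> pP qQ; apply: contraNF nt => epq; apply/touchP; exists p, q.
apply: (connected_set_const (f := fun p => (p < q1)%O (+) (p < q2)%O) _ cP p1P p2P).
move=> u v uP vP euv /=.
(* Regrouping the four terms makes the claim, for a fixed edge [uv] of [P], an invariant along the
   edges of [Q]. *)
have : (u < q1)%O (+) (v < q1)%O = (u < q2)%O (+) (v < q2)%O.
  apply: (connected_set_const (f := fun q => (u < q)%O (+) (v < q)%O) _ cQ q1Q q2Q).
  move=> x y xQ yQ exy /=; have := crossing_free_parity euv exy.
  rewrite !neqPQ // !nadj //= => /(_ isT isT).
  by do 4!case: (_ < _)%O.
by do 4!case: (_ < _)%O.
Qed.

(** By contraposition [c_mono] says that [c] is non-decreasing, so its fibres are consecutive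
    intervals. *)
Variable c : V -> nat.
Hypothesis c_mono : forall u v, c u < c v -> (u < v)%O.

Let meets P i := exists2 p, p \in P & c p = i.

Let lt_c i j p q : i < j -> c p = i -> c q = j -> (p < q)%O * ((q < p)%O = false).
Proof.
move=> ij cp cq; have pq : (p < q)%O by apply: c_mono; rewrite cp cq.
by split=> //; apply: lt_gtF.
Qed.

(** Pick a point of [P] and one of [Q] in each interval. Only the comparisons within an interval are
    unknown, and without touching the parity law makes these three booleans pairwise different,
    which is impossible. *)
Lemma three_intervals_touch P Q i j k : i < j -> j < k ->
    connected_set e P -> connected_set e Q -> [disjoint P & Q] ->
    meets P i -> meets P j -> meets P k -> meets Q i -> meets Q j -> meets Q k ->
  touch e P Q.
Proof.
move=> ij jk cP cQ PQ [p1 p1P c1] [p2 p2P c2] [p3 p3P c3].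
move=> [q1 q1Q d1] [q2 q2Q d2] [q3 q3Q d3]; apply: contraT => nt.
have par := untouched_parity cP cQ PQ nt; have ik := ltn_trans ij jk.
have := par _ _ _ _ p1P p2P q1Q q2Q.
have := par _ _ _ _ p1P p3P q1Q q3Q.
have := par _ _ _ _ p2P p3P q2Q q3Q.
rewrite (lt_c ij c1 d2) (lt_c ij d1 c2) (lt_c ik c1 d3) (lt_c ik d1 c3).
rewrite (lt_c jk c2 d3) (lt_c jk d2 c3).
by case: (p1 < q1)%O; case: (p2 < q2)%O; case: (p3 < q3)%O.
Qed.

Lemma crossing_touch P Q i j k l : i < j -> j < k -> k < l ->
    connected_set e P -> connected_set e Q -> [disjoint P & Q] ->
    meets P i -> meets P k -> meets Q j -> meets Q l ->
  touch e P Q.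
Proof.
move=> ij jk kl cP cQ PQ [p1 p1P c1] [p3 p3P c3].
move=> [q2 q2Q d2] [q4 q4Q d4]; apply: contraT => nt.
have := untouched_parity cP cQ PQ nt p1P p3P q2Q q4Q.
by rewrite (lt_c ij c1 d2) (lt_c (ltn_trans ij (ltn_trans jk kl)) c1 d4)
           (lt_c jk d2 c3) (lt_c kl c3 d4).
Qed.

Hypothesis c_le3 : forall v, c v <= 3.
Hypothesis V_gt0 : 0 < #|V|.

Let level i := [set v | c v == i].

Let levelP P i : (exists2 p, p \in P & p \in level i) -> meets P i.
Proof. by case=> p pP; rewrite inE => /eqP cp; exists p. Qed.

Let family n (F : 'I_n -> {set V}) i k :=
  [/\ forall a, connected_set e (F a), forall a, meets (F a) i,
      forall a, meets (F a) k & forall a b, a != b -> [disjoint F a & F b]].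

Let avoids P i := [forall p in P, c p != i].

(** The members that also meet interval [j] meet three common intervals, hence pairwise touch and
    form a complete minor. *)
Let family_avoid n (F : 'I_n -> {set V}) i k j : family F i k ->
    uniq [:: i; j; k] ->
  #|[set a | ~~ avoids (F a) j]| <= hadwiger e.
Proof.
case=> cF Fi Fk Fd; rewrite /= !inE negb_or => /and3P[/andP[ij ik] jk _].
have hit a : a \in [set a | ~~ avoids (F a) j] -> meets (F a) j.
  by rewrite inE negb_forall => /existsP[p]; rewrite negb_imply negbK => /andP[pF /eqP]; exists p.
apply: (hadwiger_ge (S := F)) => [a _|a b aJ bJ ab].
  by rewrite cF andbT; have [p pF _] := Fi a; apply/set0Pn; exists p.
rewrite Fd //=; have [dab [Fai Fbi] [Fak Fbk] [aj bj]] :=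
  And4 (Fd a b ab) (conj (Fi a) (Fi b)) (conj (Fk a) (Fk b)) (conj (hit a aJ) (hit b bJ)).
move: ij ik jk; rewrite !neq_ltn => /orP[]ij /orP[]ik /orP[]jk.
- by apply: (three_intervals_touch ij jk).
- by apply: (three_intervals_touch ik jk).
- by move: (ltn_trans ij jk); rewrite ltnNge (ltnW ik).
- by apply: (three_intervals_touch ik ij).
- by apply: (three_intervals_touch ij ik).
- by move: (ltn_trans jk ij); rewrite ltnNge (ltnW ik).
- by apply: (three_intervals_touch jk ik).
- by apply: (three_intervals_touch jk ij).
Qed.

(** Source of the factor 3: at most h members are lost to each of [j] and [l], and h must remain. *)
Let family_split n (F : 'I_n -> {set V}) i k j l : n = 3 * hadwiger e ->
    family F i k -> uniq [:: i; j; k] -> uniq [:: i; l; k] ->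
  exists F' : 'I_(hadwiger e) -> {set V},
    family F' i k /\ forall a, avoids (F' a) j && avoids (F' a) l.
Proof.
move=> n3 fF uj ul; have [cF Fi Fk Fd] := fF.
pose J := [set a | avoids (F a) j && avoids (F a) l].
have hJ : hadwiger e <= #|J|.
  have /eqP : #|J| + #|~: J| = n by rewrite cardsC card_ord.
  have : #|~: J| <= #|[set a | ~~ avoids (F a) j]| + #|[set a | ~~ avoids (F a) l]|.
    apply: leq_trans (leq_card_setU _ _); apply/subset_leq_card/subsetP => a.
    by rewrite !inE negb_and.
  have := leq_add (family_avoid fF uj) (family_avoid fF ul).
  by move=> le1 le2 /eqP eqn; lia.
pose v a : 'I_n := enum_val (widen_ord hJ a).
have v_inj : injective v by move=> a b /enum_val_inj/(congr1 val) /= /val_inj.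
exists (F \o v); split; first by split=> //= a b ab; rewrite Fd // (inj_eq v_inj).
by move=> a; have := enum_valP (widen_ord hJ a); rewrite inE.
Qed.

Lemma not_both_linked : linked e (level 0) (level 2) (3 * hadwiger e) ->
  ~ linked e (level 1) (level 3) (3 * hadwiger e).
Proof.
move=> [F [cF F0 F2 Fd]] [G [cG G1 G3 Gd]].
have fF : family F 0 2 by split=> // a; apply: levelP.
have fG : family G 1 3 by split=> // a; apply: levelP.
have [P [[cP P0 P2 Pd] Pav]] := family_split (j := 1) (l := 3) erefl fF isT isT.
have [Q [[cQ Q1 Q3 Qd] Qav]] := family_split (j := 0) (l := 2) erefl fG isT isT.
have PQd i j : [disjoint P i & Q j].
  apply/pred0P => z /=; apply/negbTE/negP => /andP[zP zQ].
  have /andP[/forall_inP/(_ z zP) c1 /forall_inP/(_ z zP) c3] := Pav i.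
  have /andP[/forall_inP/(_ z zQ) c0 /forall_inP/(_ z zQ) c2] := Qav j.
  by move: (c_le3 z) c0 c1 c2 c3; case: (c z) => [|[|[|[|[]]]]].
have neP i : P i != set0 by have [p pP _] := P0 i; apply/set0Pn; exists p.
have neQ i : Q i != set0 by have [p pP _] := Q1 i; apply/set0Pn; exists p.
have PQt i j : touch e (P i) (Q j).
  exact: (@crossing_touch _ _ 0 1 2 3).
(* Since h is positive, [n.+1] is h, and the bound reads h + 1 <= h. *)
have := hadwiger_bipartite e_sym (n := (hadwiger e).-1).
have := hadwiger_gt0 e V_gt0.
move: (hadwiger e) P Q {P0 P2 Pav Q1 Q3 Qav} cP Pd cQ Qd PQd neP neQ PQt.
case=> // n P Q cP Pd cQ Qd PQd neP neQ PQt _ /(_ P Q); rewrite ltnn.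
by move=> H; apply: notF; apply: H => // *; apply/andP.
Qed.

Lemma level_separator : exists X : {set V},
  #|X| < 3 * hadwiger e /\
  (separates e (level 0) (level 2) X \/ separates e (level 1) (level 3) X).
Proof.
have link i j : ~~ [exists X : {set V}, separates e (level i) (level j) X && (#|X| < 3 * hadwiger e)] ->
    linked e (level i) (level j) (3 * hadwiger e).
  move=> nX; apply: menger => // X sX; rewrite leqNgt; apply: contra nX => ltX.
  by apply/existsP; exists X; rewrite sX.
case: (boolP [exists X : {set V}, separates e (level 0) (level 2) X && (#|X| < 3 * hadwiger e)]).
  by case/existsP => X /andP[? ?]; exists X; split=> //; left.
case: (boolP [exists X : {set V}, separates e (level 1) (level 3) X && (#|X| < 3 * hadwiger e)]).
  by case/existsP => X /andP[? ?]; exists X; split=> //; right.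
by move=> /link l13 /link /not_both_linked.
Qed.

(** A connected set avoiding [X] cannot meet both separated intervals. This form hides which
    opposite pair was separated. *)
Lemma level_separator_connected : exists2 X : {set V}, #|X| < 3 * hadwiger e &
  forall K, connected_set e K -> [disjoint K & X] ->
    exists2 i, i <= 3 & forall v, v \in K -> c v != i.
Proof.
have [X [ltX sX]] := level_separator; exists X => // K /connected_setP cK KX.
have miss i j : separates e (level i) (level j) X ->
    (forall v, v \in K -> c v != i) \/ (forall v, v \in K -> c v != j).
  move/separatesP => sij.
  have [/forall_inP|] := boolP [forall v in K, c v != i]; first by left.
  rewrite negb_forall => /existsP[a]; rewrite negb_imply negbK => /andP[aK ca].
  right=> b bK; apply/negP => cb.
  have /negP[] : ~~ connect (induced e (~: X)) a b.
    by apply: sij; rewrite !inE ?(disjointFr KX aK) ?(disjointFr KX bK).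
  apply: connect_induced_mono (cK a b aK bK) => //.
  by rewrite -disjoints_subset.
by case: sX => /miss[]; [exists 0 | exists 2 | exists 1 | exists 3].
Qed.

End TimesFree.

(** * Balanced separators from four intervals *)

Section BalancedSeparator.
Variables (d : Order.disp_t) (V : finOrderType d) (e : rel V).
Hypotheses (e_sym : symmetric e) (e_free : times_free e).

Lemma balanced_separator (W : {set V}) : 0 < #|V| -> #|W| = 4 * (3 * hadwiger e) ->
  exists2 X : {set V}, #|X| < 3 * hadwiger e &
    forall K, connected_set e K -> [disjoint K & X] ->
      #|W :&: K| <= 3 * (3 * hadwiger e).
Proof.
move=> V_gt0; have := hadwiger_gt0 e V_gt0; move E : (3 * hadwiger e) => q h_gt0 cW.
have q_gt0 : 0 < q by lia.
pose n v := #|[set w in W | (w < v)%O]|.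
have n_mono u v : (u <= v)%O -> n u <= n v.
  move=> uv; apply/subset_leq_card/subsetP => w; rewrite !inE => /andP[-> wu].
  exact: lt_le_trans wu uv.
have n_lt u v : u \in W -> (u < v)%O -> n u < n v.
  move=> uW uv; apply/proper_card/properP; split.
    by apply/subsetP => w; rewrite !inE => /andP[-> /lt_trans]; apply.
  by exists u; rewrite !inE uW ?uv ?ltxx.
have n_inj : {in W &, injective n}.
  move=> u v uW vW nuv; case: (ltgtP u v) => // [/(n_lt _ _ uW)|/(n_lt _ _ vW)];
  by rewrite nuv ltnn.
have n_max w : w \in W -> n w < 4 * q.
  move=> wW; rewrite -cW; apply/proper_card/properP; split.
    by apply/subsetP => u; rewrite inE => /andP[].
  by exists w; rewrite ?inE ?wW ?ltxx.
(* The ranks [n] of the vertices of [W] fill 0, ..., 4q - 1, so each interval gets q of them; the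
   cap at 3 is for vertices beyond all of [W], whose rank is 4q. *)
pose c v := minn 3 (n v %/ q).
have c_mono u v : c u < c v -> (u < v)%O.
  apply: contraLR; rewrite -leNgt -leqNgt => /n_mono /(leq_div2r q).
  by rewrite /c; lia.
have c_le3 v : c v <= 3 by apply: geq_minl.
have [X ltX sX] := level_separator_connected e_sym e_free c_mono c_le3 V_gt0.
rewrite E in ltX; exists X => // K cK KX; have [i i3 Ki] := sX K cK KX.
(* [K] misses the block of q ranks belonging to interval [i]; closing this gap injects [W :&: K]
   into the numbers below 3q. *)
pose g w := if n w < q * i then n w else n w - q.
have g_dom w : w \in W :&: K -> n w < 4 * q /\ ((n w < q * i) || (q * i + q <= n w)).
  case/setIP => wW /Ki cw; split; first exact: n_max.
  apply: contraNT cw; rewrite negb_or -leqNgt -ltnNge => /andP[le_n n_le].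
  have -> : c w = minn 3 i; last by apply/eqP/minn_idPr.
  congr minn; apply/eqP; rewrite eqn_leq -ltnS ltn_divLR // leq_divRL //.
  by rewrite mulSn [i * q]mulnC addnC n_le.
have g_inj : {in W :&: K &, injective g}.
  move=> u v uWK vWK guv; apply: n_inj; [by case/setIP: uWK|by case/setIP: vWK|].
  have [_ du] := g_dom u uWK; have [_ dv] := g_dom v vWK.
  move: guv du dv; rewrite /g; case: ltnP => ?; case: ltnP => ? /=; lia.
rewrite cardE -(size_map g) -[3 * q](size_iota 0); apply: uniq_leq_size.
  rewrite map_inj_in_uniq ?enum_uniq // => u v; rewrite !mem_enum; exact: g_inj.
move=> _ /mapP[w + ->]; rewrite mem_enum mem_iota => /g_dom[nw dw].
have : q * i <= q * 3 by rewrite leq_mul2l i3 orbT.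
by move: dw; rewrite /g add0n /=; case: ltnP => /= *; lia.
Qed.

End BalancedSeparator.

(** * Tree decompositions from separators *)

Section RunningIntersection.
Variable V : finType.
Implicit Types (s : seq {set V}) (b Y : {set V}).

Local Notation "s `_ i" := (nth set0 s i).

(** The running intersection property: a tree decomposition listed from its root, [i] being a parent
    of [j]. On lists, gluing decompositions is concatenation. *)
Definition rip s := forall j, 0 < j < size s ->
  exists2 i, i < j & forall l, l < j -> s`_j :&: s`_l \subset s`_i.

Lemma rip1 b : rip [:: b].
Proof. by case=> [|[]]. Qed.

(** The root of [s2] is hung below the root of [s1]. A later bag of [s2] keeps its parent: it meets
    bags of [s1] only inside [Y], hence inside the root of [s2]. *)
Lemma rip_cat s1 s2 Y : rip s1 -> rip s2 -> 0 < size s1 ->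
    {in s1 & s2, forall b c, b :&: c \subset Y} ->
    Y \subset s1`_0 -> Y \subset s2`_0 ->
  rip (s1 ++ s2).
Proof.
move=> rip1 rip2 s1_gt0 s12 Y1 Y2 j; rewrite size_cat => /andP[j_gt0 j_lt].
have [js1|s1j] := ltnP j (size s1).
  have [|i ij Hi] := rip1 j; first by rewrite j_gt0.
  exists i => // l lj; rewrite !nth_cat js1 (ltn_trans lj js1) (ltn_trans ij js1).
  exact: Hi.
have js2 : j - size s1 < size s2 by lia.
have s2j : s2`_(j - size s1) \in s2 by apply: mem_nth.
have cap l : l < size s1 -> s2`_(j - size s1) :&: s1`_l \subset Y.
  by move=> ls1; rewrite setIC s12 // mem_nth.
have [j0|j1] := posnP (j - size s1).
  exists 0 => // l lj; have ls1 : l < size s1 by lia.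
  rewrite !nth_cat s1_gt0 ls1 ltnNge s1j /=.
  exact: subset_trans (cap l ls1) Y1.
have [|i ij Hi] := rip2 (j - size s1); first by rewrite j1.
exists (size s1 + i); first by lia.
move=> l lj; rewrite !nth_cat [j < _]ltnNge s1j [_ + i < _]ltnNge leq_addr addKn /=.
have [ls1|s1l] := ltnP l (size s1); last by apply: Hi; lia.
apply: subset_trans (Hi 0 j1); rewrite subsetI subsetIl.
exact: subset_trans (cap l ls1) Y2.
Qed.

Section Tree.
Variable s : seq {set V}.
Hypotheses (s_rip : rip s) (s_gt0 : 0 < size s).

Let n := size s.

(** The default [j] is taken at the root 0, which the guards in [tree_edge] exclude. *)
Definition parent (j : 'I_n) : 'I_n := odflt j
  [pick i : 'I_n | (i < j) && [forall l : 'I_n, (l < j) ==> (s`_j :&: s`_l \subset s`_i)]].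

Lemma parentP (j : 'I_n) : 0 < j ->
  parent j < j /\ (forall l, l < j -> s`_j :&: s`_l \subset s`_(parent j)).
Proof.
move=> j_gt0; rewrite /parent; case: pickP => [i /andP[ij /forallP Hi]|none] /=.
  split=> // l lj; exact: (implyP (Hi (Ordinal (ltn_trans lj (ltn_ord j))))).
have [|i ij Hi] := @s_rip j; first by rewrite j_gt0 ltn_ord.
case/negP: (none (Ordinal (ltn_trans ij (ltn_ord j)))) => /=.
by rewrite ij; apply/forallP => l; apply/implyP => lj; apply: Hi.
Qed.

Definition tree_edge : rel 'I_n :=
  [rel i j : 'I_n | (0 < i) && (parent i == j) || (0 < j) && (parent j == i)].

Lemma tree_edge_sym : symmetric tree_edge.
Proof. by move=> i j; rewrite /tree_edge /= orbC. Qed.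

Lemma tree_edge_connected (A : {set 'I_n}) (r : 'I_n) : r \in A ->
    (forall j, j \in A -> j != r -> 0 < j /\ parent j \in A) ->
  connected_set tree_edge A.
Proof.
move=> rA Ar; apply: (connected_set_from (z := r)); first exact: tree_edge_sym.
move=> j; have [m] := ubnP j; elim: m j => // m IHm j; rewrite ltnS => jm jA.
have [->|jr] := eqVneq j r; first exact: connect0.
have [j_gt0 pA] := Ar j jA jr; have [pj _] := parentP j_gt0.
apply: connect_trans (IHm _ (leq_trans pj jm) pA) (connect1 _).
by rewrite /induced /tree_edge /= pA jA j_gt0 eqxx orbT.
Qed.

Lemma tree_edge_lt (i j : 'I_n) : tree_edge i j -> j <= i -> parent i = j.
Proof.
case/orP => /andP[gt0 /eqP p] // ji.
by have [] := parentP gt0; rewrite p ltnNge ji.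
Qed.

Lemma tree_edge_tree : is_tree tree_edge.
Proof.
split.
- exact: tree_edge_sym.
- by move=> i; apply/negbTE/negP => /orP[]/andP[/parentP[+ _] /eqP p]; rewrite p ltnn.
- by rewrite card_ord.
- apply: (tree_edge_connected (r := Ordinal s_gt0)) => [|j _ j0]; first by rewrite inE.
  by rewrite inE lt0n.
(* On a cycle both neighbours of the largest index would be its parent, hence equal. *)
- move=> c uc; rewrite leqNgt; apply/negP => c_gt2.
  have [m mc m_max] : exists2 m, m \in c & forall x, x \in c -> x <= m.
    case: c c_gt2 {uc} => // x c _.
    have [m mc m_max] := @arg_maxnP _ x (mem (x :: c)) val (mem_head x c).
    by exists m.
  have [k c' ck] := rot_to mc; move: uc; rewrite -(rot_ucycle k) ck.
  have m_max' x : x \in m :: c' -> x <= m by rewrite -ck mem_rot; apply: m_max.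
  have : 2 < size (m :: c') by rewrite -ck size_rot.
  case: c' {ck} m_max' => // a c'; elim/last_ind: c' => // c' b _ m_max' _.
  case/andP => /= /andP[ma]; rewrite !rcons_path last_rcons => /andP[_ bm].
  have ab : a \in m :: a :: rcons c' b by rewrite !inE eqxx orbT.
  have bb : b \in m :: a :: rcons c' b by rewrite !inE mem_rcons mem_head !orbT.
  rewrite tree_edge_sym in bm.
  have pa := tree_edge_lt ma (m_max' _ ab).
  have pb := tree_edge_lt bm (m_max' _ bb).
  by rewrite -pa pb mem_rcons mem_head andbF.
Qed.

Lemma rip_tree_decomposition (e : rel V) :
    (forall u v, (u == v) || e u v -> exists2 b, b \in s & (u \in b) && (v \in b)) ->
  is_tree_decomposition e tree_edge (fun t => s`_t).
Proof.
move=> cover.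
have cover' u v : (u == v) || e u v -> exists t : 'I_n, (u \in s`_t) && (v \in s`_t).
  move=> /cover[b bs buv]; have bn : index b s < n by rewrite index_mem.
  by exists (Ordinal bn); rewrite /= nth_index.
split.
- exact: tree_edge_tree.
- by move=> v; have [|t /andP[]] := cover' v v; [rewrite eqxx | exists t].
- by move=> u v euv; apply: cover'; rewrite euv orbT.
- move=> v; have [|t /andP[vt _]] := cover' v v; first by rewrite eqxx.
  (* The first bag containing [v] is the root of its subtree: any later bag containing [v] shares
     [v] with it, so its parent contains [v] too. *)
  have [r vr r_min] := @arg_minnP _ t (fun t => v \in s`_t) val vt.
  apply: (tree_edge_connected (r := r)); first by rewrite inE.
  move=> j; rewrite !inE => vj jr.
  have rj : r < j by rewrite ltn_neqAle r_min // andbT eq_sym val_eqE.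
  have j_gt0 : 0 < j by apply: leq_ltn_trans rj.
  split=> //; have [_ /(_ r rj)/subsetP] := parentP j_gt0.
  by apply; rewrite inE vj.
Qed.

End Tree.

Lemma treewidth_rip (e : rel V) s k : rip s -> 0 < size s ->
    (forall u v, (u == v) || e u v -> exists2 b, b \in s & (u \in b) && (v \in b)) ->
    (forall b, b \in s -> #|b| <= k) ->
  treewidth e <= k.-1.
Proof.
move=> s_rip s_gt0 cover le_k; rewrite /treewidth; case: ex_minnP => m _ m_min.
apply: leq_trans (m_min (width (fun t : 'I_(size s) => s`_t)) _) _.
  apply/boolp.asboolP; exists 'I_(size s), (@tree_edge s), (fun t : 'I_(size s) => s`_t); split=> //.
  exact: rip_tree_decomposition.
rewrite /width -!subn1 leq_sub2r //; apply/bigmax_leqP => t _.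
by apply: le_k; rewrite mem_nth.
Qed.

End RunningIntersection.

(** * Recursive decomposition along balanced separators *)

Section Separators.
Variables (V : finType) (e : rel V) (q : nat).
Hypothesis e_sym : symmetric e.
Hypothesis q_gt0 : 0 < q.
Hypothesis separator : forall W : {set V}, #|W| = 4 * q ->
  exists2 X : {set V}, #|X| < q &
    forall K, connected_set e K -> [disjoint K & X] -> #|W :&: K| <= 3 * q.
Implicit Types (U W X Z K : {set V}).

Lemma extend_set U W k : W \subset U -> #|W| <= k <= #|U| ->
  exists W', [/\ W \subset W', W' \subset U & #|W'| = k].
Proof.
move=> WU /andP[Wk kU].
pose D := [set x in take (k - #|W|) (enum (U :\: W))].
have DU : D \subset U :\: W.
  by apply/subsetP => x; rewrite inE => /mem_take; rewrite mem_enum.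
exists (W :|: D); split; first exact: subsetUl.
  by rewrite subUset WU (subset_trans DU (subsetDl _ _)).
have WD : W :&: D = set0.
  apply/eqP; rewrite setI_eq0 disjoint_sym.
  by move: DU; rewrite subsetD => /andP[].
have cD : #|D| = k - #|W|.
  rewrite cardsE; have /card_uniqP-> : uniq (take (k - #|W|) (enum (U :\: W))).
    by rewrite take_uniq // enum_uniq.
  rewrite size_take -cardE cardsD (setIidPr WU); case: ltnP => //.
  by move: Wk kU; lia.
by rewrite cardsU WD cards0 cD; lia.
Qed.

Lemma component_connected Z z :
  connected_set e [set v | connect (induced e Z) z v].
Proof.
set K := [set v | _]; have zK : z \in K by rewrite inE connect0.
apply: (connected_set_from (z := z)) => // v; rewrite inE => czv.
have : (v \in K) && connect (induced e K) z v; last by case/andP.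
apply: (connect_stable (P := fun v => (v \in K) && connect (induced e K) z v)) czv _.
  move=> u w Zuw /andP[uK cu].
  have wK : w \in K by move: uK; rewrite !inE => cu'; apply: connect_trans cu' (connect1 Zuw).
  rewrite wK; apply: connect_trans cu (connect1 _).
  by case/andP: Zuw => euw _; rewrite /induced /= euw uK wK.
by rewrite zK connect0.
Qed.

(** [W] is required in the root bag so that the decomposition can be glued to another along [W]. *)
Definition decomposes s U W := [/\ rip s, 0 < size s, W \subset nth set0 s 0,
  forall b, b \in s -> b \subset U /\ #|b| < 5 * q &
  forall u v, u \in U -> v \in U -> (u == v) || e u v ->
    exists2 b, b \in s & (u \in b) && (v \in b)].

(** Enlarge [W] to 4q vertices and take a balanced separator [X] of it; the root bag is their union.
    Each component [K] of [U :\: X] is handled by recursion on [K :|: X] with interface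
    [(W :&: K) :|: X], which has at most 3q + (q - 1) < 4q vertices. *)
Lemma separator_decomposition U W : W \subset U -> #|W| < 4 * q ->
  exists s, decomposes s U W.
Proof.
have [n] := ubnP #|U|; elim: n U W => // n IHn U W0; rewrite ltnS => Un WU W0q.
have [U_small|U_big] := ltnP #|U| (4 * q).
  exists [:: U]; split=> //; first exact: rip1.
    by move=> b; rewrite inE => /eqP->; split=> //; lia.
  by move=> u v uU vU _; exists U; rewrite ?inE ?uU.
have [W [W0W {}WU cW]] : exists W, [/\ W0 \subset W, W \subset U & #|W| = 4 * q].
  by apply: extend_set; rewrite // (ltnW W0q).
have [X0 X0q sX] := separator cW; pose X := X0 :&: U; pose r := W :|: X.
have XU : X \subset U := subsetIr _ _.
have Xq : #|X| < q by apply: leq_ltn_trans X0q; apply/subset_leq_card/subsetIl.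
have rU : r \subset U by rewrite subUset WU XU.
have rq : #|r| < 5 * q by have := leq_of_leqif (leq_card_setU W X); rewrite /r; lia.
(* Inner induction: [Z] is a union of components of [U :\: X], attached to the root bag [r] one at a
   time. *)
have glue Z : Z \subset U :\: X ->
    (forall u v, u \in Z -> v \in U :\: X -> e u v -> v \in Z) ->
  exists s, [/\ rip s, 0 < size s, nth set0 s 0 = r,
    forall b, b \in s -> b \subset Z :|: r /\ #|b| < 5 * q &
    forall u v, u \in Z :|: X -> v \in Z :|: X -> (u == v) || e u v ->
      exists2 b, b \in s & (u \in b) && (v \in b)].
  have [m] := ubnP #|Z|; elim: m Z => // m IHm Z; rewrite ltnS => Zm ZU Zcl.
  have [Z0|[z zZ]] := set_0Vmem Z.
    exists [:: r]; split=> //; first exact: rip1.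
      by move=> b; rewrite inE => /eqP->; rewrite subsetUr.
    move=> u v; rewrite Z0 set0U => uX vX _; exists r; first by rewrite inE.
    by rewrite !in_setU uX vX !orbT.
  pose K := [set v | connect (induced e (U :\: X)) z v].
  have zK : z \in K by rewrite inE connect0.
  have Kcl u v : u \in K -> u \in Z -> v \in U :\: X -> e u v -> v \in K.
    rewrite [u \in K]inE [v \in K]inE => czu uZ vUX euv.
    apply: connect_trans czu (connect1 _).
    by rewrite /induced /= euv vUX (subsetP ZU).
  have KZ : K \subset Z.
    apply/subsetP => v; rewrite inE => czv.
    apply: (connect_stable (P := mem Z)) czv zZ => u w /and3P[euw _ wUX] uZ.
    exact: Zcl uZ wUX euw.
  have KX : [disjoint K & X].
    by have := subset_trans KZ ZU; rewrite subsetD => /andP[].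
  have KU : K \subset U by apply: subset_trans KZ (subset_trans ZU (subsetDl _ _)).
  have KX0 : [disjoint K & X0].
    apply/pred0P => v /=; apply/negbTE/negP => /andP[vK vX0].
    have : v \in X by rewrite inE vX0 (subsetP KU).
    by rewrite (disjointFr KX vK).
  pose UK := K :|: X; pose WK := (W :&: K) :|: X.
  have WKq : #|WK| < 4 * q.
    have := sX K (component_connected _ _) KX0; have := leq_of_leqif (leq_card_setU (W :&: K) X).
    by rewrite /WK; lia.
  (* If [UK] were all of [U], then [W] would lie in [WK], which has fewer than 4q vertices. *)
  have UKn : #|UK| < n.
    apply: leq_trans Un; apply/proper_card/properP; split; first by rewrite subUset KU XU.
    apply/subsetPn; apply: contraTN WKq => UUK; rewrite -leqNgt -cW.
    apply/subset_leq_card/subsetP => v vW.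
    have : v \in UK by apply: (subsetP UUK); apply: (subsetP WU).
    by rewrite !in_setU in_setI vW.
  have WKUK : WK \subset UK by apply: setSU; apply: subsetIr.
  have [s2 [rip2 s2_gt0 W2 b2 cov2]] := IHn UK WK UKn WKUK WKq.
  have [|||s1 [rip1 s1_gt0 r1 b1 cov1]] := IHm (Z :\: K).
  - apply: leq_trans Zm; apply/proper_card/properP; split; first exact: subsetDl.
    by exists z; rewrite // inE zK.
  - exact: subset_trans (subsetDl _ _) ZU.
  - move=> u v /setDP[uZ uK] vUX euv; rewrite inE (Zcl u v) // andbT.
    apply: contra uK => vK; apply: (Kcl v u) => //; first exact: (subsetP KZ).
      exact: (subsetP ZU).
    by rewrite e_sym.
  exists (s1 ++ s2); split.
  - apply: (rip_cat (Y := WK)) => // [b c bs1 cs2|].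
      have [/subsetP bZ _] := b1 b bs1; have [/subsetP cK _] := b2 c cs2.
      apply/subsetP => v /setIP[/bZ vb /cK]; move: vb.
      rewrite !in_setU in_setD in_setI => vb /orP[vK|->]; last by rewrite orbT.
      by move: vb; rewrite vK (disjointFr KX vK) /= !orbF andbT.
    by rewrite r1; apply: setSU; apply: subsetIl.
  - by rewrite size_cat addn_gt0 s1_gt0.
  - by rewrite nth_cat s1_gt0.
  - move=> b; rewrite mem_cat => /orP[/b1|/b2] [bU bq]; split=> //.
      by apply: subset_trans bU (setSU _ _); apply: subsetDl.
    apply: subset_trans bU _; apply: setUSS => //; exact: subsetUr.
  - move=> u v uZX vZX uv.
    have inUK x y : x \in K -> y \in Z :|: X -> (x == y) || e x y -> y \in UK.
      move=> xK /setUP[yZ|yX]; last by rewrite in_setU yX orbT.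
      case/orP=> [/eqP<-|exy]; rewrite in_setU; first by rewrite xK.
      by rewrite (Kcl x y) // ?(subsetP KZ) // (subsetP ZU).
    have s2P : u \in UK -> v \in UK -> exists2 b, b \in s1 ++ s2 & (u \in b) && (v \in b).
      by move=> uK vK; have [b bs ?] := cov2 u v uK vK uv; exists b; rewrite // mem_cat bs orbT.
    have [uK|uK] := boolP (u \in K).
      by apply: s2P; [rewrite in_setU uK | apply: inUK uv].
    have [vK|vK] := boolP (v \in K).
      apply: s2P; last by rewrite in_setU vK.
      by apply: inUK vK uZX _; rewrite eq_sym e_sym.
    have [|||b bs ?] := cov1 u v => //; last by exists b; rewrite // mem_cat bs.
      by move: uZX; rewrite !in_setU in_setD uK.
    by move: vZX; rewrite !in_setU in_setD vK.
have [//|u v _ //|s [s_rip s_gt0 s0 bs cov]] := glue (U :\: X).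
exists s; split=> //.
- by rewrite s0; apply: subset_trans W0W (subsetUl _ _).
- move=> b /bs[bU bq]; split=> //; apply: subset_trans bU _.
  by rewrite subUset subsetDl.
- have UE : U :\: X :|: X = U.
    apply/setP => v; rewrite in_setU in_setD.
    by case: (boolP (v \in X)) => [/(subsetP XU)->|_]; rewrite ?orbF.
  by move=> u v uU vU; apply: cov; rewrite UE.
Qed.

Lemma treewidth_separator : treewidth e <= (5 * q).-2.
Proof.
have [|s [s_rip s_gt0 _ bs cov]] := @separator_decomposition [set: V] set0 (sub0set _).
  by rewrite cards0; lia.
apply: treewidth_rip s_rip s_gt0 _ _ => [u v uv|b /bs[_ bq]]; first by apply: cov; rewrite ?inE.
by lia.
Qed.

End Separators.

Theorem theorem23 (d : Order.disp_t) (V : finOrderType d) (e : rel V)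
    (e_sym : symmetric e) (e_irr : irreflexive e) (V_gt0 : 0 < #|V|)
    (e_free : times_free e) :
  ((treewidth e)%:Z <= 15%:Z * (hadwiger e)%:Z - 2%:Z)%R.
Proof.
have h_gt0 := hadwiger_gt0 e V_gt0.
have q_gt0 : 0 < 3 * hadwiger e by rewrite muln_gt0.
(* With q = 3h and h positive, the truncated [(5 * q).-2] is the integer 15h - 2. *)
have := treewidth_separator e_sym q_gt0 (fun W => @balanced_separator _ _ _ e_sym e_free W V_gt0).
lia.
Qed.
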